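(* Let $L\ge 1$ and $S\ge 0$ be integers with $L+S\ge 2$, and let $n\ge 1$. Then the first $t_n$ points of the $LS$-sequence of points $\{\xi_{L,S}^m\}_{m\ge1}$ are $$\Lambda_{L,S}^n=\{\psi_{i_1i_2\dots i_n}(0)\},$$ where $(i_n,i_{n-1},\dots,i_1)$ ranges over the $n$-tuples of elements of $\{0,1,\dots,L+S-1\}$ such that $(i_h,i_{h+1})\notin E_{L,S}$ for all $1\le h\le n-1$, ordered with respect to the magnitude of the number whose base-$(L+S)$ digit string is $i_ni_{n-1}\dots i_1$ (i.e. of $\sum_{k=1}^n i_k(L+S)^{k-1}$). The equality is one of ordered lists: the $m$-th point of $\Lambda_{L,S}^n$ is $\psi_{i_1\dots i_n}(0)$ for the $m$-th admissible tuple in this order.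
   Context: Fix integers $L\ge 1$, $S\ge 0$ with $L+S\ge 2$, and let $\gamma$ be the positive solution of $Lx+Sx^2=1$ (so $\gamma=1/L$ if $S=0$). **$LS$-sequence of partitions.** Let $\rho_{L,S}$ be the partition of $[0,1[$ into $L$ consecutive ''long'' intervals of length $\gamma$ followed by $S$ consecutive ''short'' intervals of length $\gamma^2$. Set $\rho_{L,S}^0=\{[0,1[\}$ and, for $n\ge 1$, let $\rho_{L,S}^n$ be obtained from $\rho_{L,S}^{n-1}$ by subdividing every interval of maximal length positively homothetically to $\rho_{L,S}$. Let $t_n$, $l_n$, $s_n$ be the total number of intervals, the number of long intervals (length $\gamma^n$) and the number of short intervals (length $\gamma^{n+1}$) of $\rho_{L,S}^n$. Then $t_n=l_n+s_n$, $l_n=L\,l_{n-1}+s_{n-1}$, $s_n=S\,l_{n-1}$, $l_0=1$, $s_0=0$. **$LS$-sequence of points.** For $n\ge 1$ define $$\varphi_i^{(n+1)}(x)=x+i\gamma^{n+1},\qquad \varphi_{L,j}^{(n+1)}(x)=x+L\gamma^{n+1}+j\gamma^{n+2},$$ for $1\le i\le L$ and $1\le j\le S-1$ if $S\ge 1$; if $S=0$ only the functions $\varphi_i^{(n+1)}$ with $1\le i\le L-1$ are used. Let $\Lambda_{L,S}^1$ be the list, in increasing order, of the $t_1=L+S$ left endpoints of the intervals of $\rho_{L,S}^1$. If $\Lambda_{L,S}^n=(\xi_1^{(n)},\dots,\xi_{t_n}^{(n)})$, then $\Lambda_{L,S}^{n+1}$ is the ordered list $$\big(\xi_1^{(n)},\dots,\xi_{t_n}^{(n)},\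 \varphi_1^{(n+1)}(\xi_1^{(n)}),\dots,\varphi_1^{(n+1)}(\xi_{l_n}^{(n)}),\ \dots,\ \varphi_L^{(n+1)}(\xi_1^{(n)}),\dots,\varphi_L^{(n+1)}(\xi_{l_n}^{(n)}),$$ $$\varphi_{L,1}^{(n+1)}(\xi_1^{(n)}),\dots,\varphi_{L,1}^{(n+1)}(\xi_{l_n}^{(n)}),\ \dots,\ \varphi_{L,S-1}^{(n+1)}(\xi_1^{(n)}),\dots,\varphi_{L,S-1}^{(n+1)}(\xi_{l_n}^{(n)})\big)$$ (if $S=0$ the blocks are those of $\varphi_1^{(n+1)},\dots,\varphi_{L-1}^{(n+1)}$ only). The $LS$-sequence of points $\{\xi_{L,S}^m\}_{m\ge1}$ is the infinite sequence whose first $t_n$ terms are, in order, the list $\Lambda_{L,S}^n$, for every $n\ge 1$. **The functions $\psi_i$.** For $0\le i\le L-1$ let $\psi_i(x)=\gamma x+i\gamma$, with domain $0\le x<1$. If $S\ge 1$, for $L\le i\le L+S-1$ let $\psi_i(x)=\gamma x+L\gamma+(i-L)\gamma^2$, with domain $0\le x<\gamma$. Let $$E_{L,S}=\{L,L+1,\dots,L+S-1\}\times\{1,\dots,L+S-1\}$$ (empty if $S=0$); these are the pairs $(i,j)$ for which $\psi_i\circ\psi_j$ is not defined. Write $\psi_{i_1i_2\dots i_n}=\psi_{i_1}\circ\psi_{i_2}\circ\cdots\circ\psi_{i_n}$. *)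

(* Defs.v *)
From mathcomp Require Import all_boot all_order all_algebra.
From mathcomp Require Import reals.

Set Implicit Arguments.
Unset Strict Implicit.
Unset Printing Implicit Defensive.

Import Order.TTheory GRing.Theory Num.Theory.
Local Open Scope ring_scope.

Section LSSequences.
Variables (R : realFieldType) (L S : nat) (gamma : R).

(* A pair (a, b) stands for the interval [a, b[; a partition of [0, 1[ is the
   sequence of its intervals, from left to right. *)
Definition ilen (U : R * R) : R := U.2 - U.1.

(* Image of V under the positive homothety x |-> a + (b - a) x, U = (a, b). *)
Definition homothetic (U V : R * R) : R * R :=
  (U.1 + ilen U * V.1, U.1 + ilen U * V.2).

Definition LS_pattern : seq (R * R) :=
  [seq (i%:R * gamma, i.+1%:R * gamma) | i <- iota 0 L] ++
  [seq (L%:R * gamma + j%:R * gamma ^+ 2, L%:R * gamma + j.+1%:R * gamma ^+ 2)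
     | j <- iota 0 S].

Definition refine (P : seq (R * R)) : seq (R * R) :=
  flatten [seq if all (fun V => ilen V <= ilen U) P
               then [seq homothetic U V | V <- LS_pattern] else [:: U]
          | U <- P].

Definition LS_partition (n : nat) : seq (R * R) := iter n refine [:: (0, 1)].

Definition nb_intervals (n : nat) : nat := size (LS_partition n).
Definition nb_long (n : nat) : nat :=
  count (fun U => ilen U == gamma ^+ n) (LS_partition n).

Definition phi (k i : nat) (x : R) : R := x + i%:R * gamma ^+ k.
Definition phiL (k j : nat) (x : R) : R :=
  x + L%:R * gamma ^+ k + j%:R * gamma ^+ k.+1.

(* Lambda 0 is a dummy value: the lists start at n = 1. *)
Fixpoint Lambda (n : nat) : seq R :=
  match n with
  | 0 => [::]
  | 1 => sort <=%R [seq U.1 | U <- LS_partition 1]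
  | m.+1 =>
      let X := Lambda m in
      let Y := take (nb_long m) X in
      X ++ flatten [seq [seq phi m.+1 i x | x <- Y]
                      | i <- iota 1 (if S == 0%N then L.-1 else L)]
        ++ flatten [seq [seq phiL m.+1 j x | x <- Y] | j <- iota 1 S.-1]
  end.

(* The m-th point, m >= 1: Lambda m has more than m terms and is a prefix of
   all later lists. *)
Definition LS_point (m : nat) : R := nth 0 (Lambda m) m.-1.

(* psi i is a partial function, None outside its domain. *)
Definition psi (i : nat) (x : R) : option R :=
  if (i < L)%N then
    if (0 <= x) && (x < 1) then Some (gamma * x + i%:R * gamma) else None
  else if (i < L + S)%N then
    if (0 <= x) && (x < gamma)
    then Some (gamma * x + L%:R * gamma + (i - L)%:R * gamma ^+ 2) else None
  else None.

(* psi_{i_1} o ... o psi_{i_n} for w = [:: i_1; ...; i_n]. *)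
Definition psi_word (w : seq nat) (x : R) : option R :=
  foldr (fun i => obind (psi i)) (Some x) w.

End LSSequences.

Definition E_LS (L S : nat) : rel nat :=
  fun i j => (L <= i < L + S)%N && (1 <= j < L + S)%N.

(* Tuples are written w = (i_1, ..., i_n), so i_{k+1} = tnth w k and i_n is the
   most significant digit. *)
Definition tuple_value (b n : nat) (w : n.-tuple 'I_b) : nat :=
  (\sum_(k < n) tnth w k * b ^ k)%N.

(* sorted relates consecutive entries: (i_h, i_{h+1}) for 1 <= h <= n - 1. *)
Definition admissible (L S n : nat) (w : n.-tuple 'I_(L + S)) : bool :=
  sorted (fun i j : 'I_(L + S) => ~~ E_LS L S i j) w.

Definition admissible_tuples (L S n : nat) : seq (n.-tuple 'I_(L + S)) :=
  sort (fun u v => (tuple_value u <= tuple_value v)%N)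
       [seq w <- enum {: n.-tuple 'I_(L + S)} | admissible w].

(* Main.v *)
(** An n-letter admissible word ends either with 0, appended to any admissible
word of length n - 1, or with a nonzero digit appended to an admissible word
whose last digit is below L.  Listed by value, the words with last digit below
L come first, and they satisfy the same recursion as the long intervals of the
partition: there are l_n of them.  Since psi_0, ..., psi_{L+S-1} are affine of
slope gamma, appending the digit i to a word of length n translates its point
by gamma^n psi_i(0), which is exactly the translation performed by the blocks
phi_i and phi_{L,j} of Lambda^{n+1} on the first l_n points. *)

Require Import Defs.
From mathcomp Require Import all_boot all_order all_algebra.
From mathcomp Require Import reals.
From mathcomp Require Import zify ring lra.

Set Implicit Arguments.
Unset Strict Implicit.
Unset Printing Implicit Defensive.

Import Order.TTheory GRing.Theory Num.Theory.
Local Open Scope ring_scope.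

(** * Digit words *)

(** The last letter, being the most significant digit, is the outer index, so the words are
    generated by increasing value. *)
Fixpoint digit_words (b n : nat) : seq (seq nat) :=
  if n is m.+1 then [seq rcons w i | i <- iota 0 b, w <- digit_words b m]
  else [:: [::]].

Definition word_value (b : nat) (w : seq nat) : nat :=
  foldr (fun i v => i + b * v)%N 0 w.

Lemma word_value_rcons b w i :
  word_value b (rcons w i) = (i * b ^ size w + word_value b w)%N.
Proof.
elim: w => [|j w IHw] /=; first by rewrite muln0 muln1.
by rewrite IHw expnS; lia.
Qed.

Lemma mem_digit_words b n (w : seq nat) :
  (w \in digit_words b n) = (size w == n) && all (fun i => i < b)%N w.
Proof.
elim: n w => [|n IHn] w /=; first by case: w.
apply/allpairsPdep/idP => [[i [v [ib vn ->]]]|].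
  rewrite mem_iota in ib; move: vn; rewrite IHn => /andP[/eqP <- vb].
  by rewrite size_rcons eqxx all_rcons vb; lia.
case/lastP: w => // w i; rewrite size_rcons eqSS all_rcons => /andP[sw /andP[ib wb]].
by exists i, w; rewrite mem_iota IHn sw wb.
Qed.

Lemma size_digit_words b n : size (digit_words b n) = (b ^ n)%N.
Proof.
by elim: n => //= n IHn; rewrite size_allpairs size_iota IHn expnS.
Qed.

Lemma allpairs_iota b c :
  [seq (i * c + j)%N | i <- iota 0 b, j <- iota 0 c] = iota 0 (b * c).
Proof.
elim: b => // b IHb.
rewrite -addn1 iotaD allpairs_cat IHb /= cats0 add0n [in RHS]mulnDl mul1n iotaD.
by rewrite add0n -[X in _ = _ ++ iota X _]addn0 iotaDl.
Qed.

(** A last letter [i] appended to a word of length [n] contributes [i * b ^ n], which matches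
    [allpairs_iota]. Distinctness and sortedness of [digit_words] are both read off from this
    identity. *)
Lemma map_word_value b n :
  [seq word_value b w | w <- digit_words b n] = iota 0 (b ^ n).
Proof.
elim: n => //= n IHn.
rewrite map_allpairs expnS -allpairs_iota -IHn allpairs_mapr.
apply/eq_in_allpairs => i w _; rewrite mem_digit_words => /andP[/eqP <- _].
exact: word_value_rcons.
Qed.

Lemma word_value_inj b n : {in digit_words b n &, injective (word_value b)}.
Proof.
move=> u v; rewrite !mem_digit_words => /andP[/eqP <- ub] /andP[/eqP].
elim: u v ub => [|i u IHu] [|j v] //= /andP[ib ub] [szv] /andP[jb vb] eq_uv.
have b_gt0 : (0 < b)%N by apply: leq_ltn_trans ib.
(* Both values take the form [v * b + i], so that reduction modulo [b] isolates the first digit. *)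
move: eq_uv; rewrite ![(_ + b * _)%N]addnC ![(b * _)%N]mulnC => eq_uv.
have eq_ij : i = j.
  by have := congr1 (modn^~ b) eq_uv; rewrite !modnMDl !modn_small.
move: eq_uv; rewrite eq_ij => /addIn/eqP; rewrite eqn_pmul2r // => /eqP.
by move/IHu => -> //; rewrite szv eqxx.
Qed.

Lemma digit_words_uniq b n : uniq (digit_words b n).
Proof. by apply: (@map_uniq _ _ (word_value b)); rewrite map_word_value iota_uniq. Qed.

Lemma tuple_value_word b n (w : n.-tuple 'I_b) :
  tuple_value w = word_value b [seq val i | i <- w].
Proof.
elim: n w => [|n IHn] w; first by rewrite tuple0 /tuple_value big_ord0.
case/tupleP: w => i w; rewrite /tuple_value big_ord_recl /= -IHn muln1.
congr (_ + _)%N; rewrite big_distrr /=; apply: eq_bigr => k _.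
by rewrite tnthS expnS mulnCA.
Qed.

(** Forgetting the bounds of the ordinals is injective and lands in [digit_words]. Both lists have
    [b ^ n] distinct entries, so inclusion suffices. *)
Lemma perm_digit_words b n :
  perm_eq [seq [seq val i | i <- w] | w : n.-tuple 'I_b <- enum {: n.-tuple 'I_b}]
          (digit_words b n).
Proof.
have inj_val : injective (fun w : n.-tuple 'I_b => [seq val i | i <- w]).
  by move=> u v /(inj_map val_inj)/val_inj.
set T := [seq _ | _ <- _].
have uniqT : uniq T by rewrite map_inj_uniq ?enum_uniq.
have subT : {subset T <= digit_words b n}.
  move=> _ /mapP[w _ ->]; rewrite mem_digit_words size_map size_tuple eqxx.
  by rewrite all_map; apply/allP => i _ /=.
apply: (uniq_perm uniqT (digit_words_uniq b n)).
apply: (uniq_min_size uniqT subT _).2.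
by rewrite size_map -cardE card_tuple card_ord size_digit_words.
Qed.

(** * Admissible words *)

Definition adm_words (L S n : nat) : seq (seq nat) :=
  [seq w <- digit_words (L + S) n | sorted (fun i j => ~~ E_LS L S i j) w].

(** Both lists are sorted by value and are permutations of each other; since the value is injective
    on words of length [n], they coincide. The sort over tuples thus becomes a filter, which lends
    itself to recursion on [n]. *)
Lemma map_admissible_tuples L S n :
  [seq [seq val i | i <- w] | w : n.-tuple 'I_(L + S) <- admissible_tuples L S n]
  = adm_words L S n.
Proof.
set b := (L + S)%N.
pose le_val := relpre (word_value b) leq.
have trV : transitive le_val by move=> ? ? ? /=; apply: leq_trans.
rewrite /admissible_tuples /adm_words.
have admE (w : n.-tuple 'I_b) : admissible w =
    sorted (fun i j => ~~ E_LS L S i j) [seq val i | i <- w].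
  by rewrite sorted_map.
set T := (X in [seq _ | _ <- X]).
have permT : perm_eq [seq [seq val i | i <- w] | w : n.-tuple 'I_b <- T]
    [seq w <- digit_words b n | sorted (fun i j => ~~ E_LS L S i j) w].
  rewrite -(permPr (perm_filter _ (perm_digit_words b n))) filter_map.
  by apply: perm_map; rewrite /T (eq_filter admE) perm_sort.
apply: (sorted_eq_in (leT := le_val)) (permT).
- by move=> u v w _ _ _; apply: trV.
- move=> u v; rewrite !(perm_mem permT) !mem_filter => /andP[_ ud] /andP[_ vd] uv.
  by apply: (word_value_inj ud vd); apply: anti_leq.
- rewrite sorted_map; under eq_sorted do rewrite /= -!tuple_value_word.
  by apply: sort_sorted => u v; apply: leq_total.
apply: (sorted_filter trV); rewrite -sorted_map map_word_value.
exact: iota_sorted.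
Qed.

(** The only new adjacent pair consists of the last letter of [w] and [i]; it is forbidden exactly
    when [i] is nonzero and that letter is at least [L]. The default [0] of [last] lets the empty
    word take any letter. *)
Lemma adm_wordsS L S n : (0 < L)%N ->
  adm_words L S n.+1 = [seq rcons w 0%N | w <- adm_words L S n] ++
    [seq rcons w i | i <- iota 1 (L + S).-1,
                     w <- [seq w <- adm_words L S n | last 0%N w < L]%N].
Proof.
move=> L_gt0; rewrite /adm_words /= filter_flatten.
have -> : iota 0 (L + S) = 0%N :: iota 1 (L + S).-1 by case: (L + S)%N (ltn_addr S L_gt0).
have adm_rcons w i : (i < L + S)%N -> w \in digit_words (L + S) n ->
    sorted (fun i j => ~~ E_LS L S i j) (rcons w i) =
    ((i == 0%N) || (last 0%N w < L)%N) && sorted (fun i j => ~~ E_LS L S i j) w.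
  move=> ib; rewrite mem_digit_words => /andP[_].
  case: w => [|j w] wb; first by rewrite /= L_gt0 orbT.
  rewrite /= rcons_path andbC; congr (_ && _).
  have : (last j w < L + S)%N := allP wb _ (mem_last j w).
  rewrite /E_LS; move: (last j w) => k; lia.
rewrite /= !filter_map; congr (_ ++ _).
  by congr (map _ _); apply: eq_in_filter => w wn /=; rewrite adm_rcons //; lia.
rewrite -map_comp; congr flatten; apply/eq_in_map => i; rewrite mem_iota => ib /=.
rewrite filter_map -filter_predI; congr (map _ _).
by apply: eq_in_filter => w wn /=; rewrite adm_rcons //; [case: i ib | lia].
Qed.

Lemma adm_long_wordsS L S n : (0 < L)%N ->
  [seq w <- adm_words L S n.+1 | last 0%N w < L]%N =
  [seq rcons w 0%N | w <- adm_words L S n] ++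
    [seq rcons w i | i <- iota 1 L.-1,
                     w <- [seq w <- adm_words L S n | last 0%N w < L]%N].
Proof.
move=> L_gt0; rewrite adm_wordsS // filter_cat filter_map.
rewrite (eq_filter (a2 := predT)) ?filter_predT; last by move=> w /=; rewrite last_rcons.
congr (_ ++ _); have -> : (L + S).-1 = (L.-1 + S)%N by lia.
rewrite iotaD allpairs_cat filter_cat -[RHS]cats0; congr (_ ++ _).
  apply/all_filterP/all_allpairsP => i w; rewrite mem_iota last_rcons; lia.
apply/eqP; rewrite -(negbK (_ == _)) -has_filter -all_predC.
apply/all_allpairsP => i w; rewrite mem_iota /= last_rcons; lia.
Qed.

Lemma size_adm_wordsS L S n : (0 < L)%N ->
  size (adm_words L S n.+1) = (size (adm_words L S n) +
    (L + S).-1 * count (fun w => last 0 w < L) (adm_words L S n))%N.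
Proof.
move=> L_gt0; rewrite adm_wordsS //.
by rewrite size_cat size_map size_allpairs size_iota size_filter.
Qed.

Lemma count_adm_long_wordsS L S n : (0 < L)%N ->
  count (fun w => last 0 w < L)%N (adm_words L S n.+1) =
  (size (adm_words L S n) + L.-1 * count (fun w => last 0 w < L) (adm_words L S n))%N.
Proof.
move=> L_gt0; rewrite -size_filter adm_long_wordsS //.
by rewrite size_cat size_map size_allpairs size_iota size_filter.
Qed.

(** This serves both to make the lists grow and to exhibit an interval of length [gamma ^ n] in each
    partition, which fixes the maximal length there. *)
Lemma adm_long_words_gt0 L S n : (0 < L)%N ->
  (0 < count (fun w => last 0 w < L) (adm_words L S n))%N.
Proof.
move=> L_gt0; elim: n => [|n IHn]; first by rewrite /adm_words /= L_gt0.
by rewrite count_adm_long_wordsS // ltn_addr // (leq_trans IHn) // count_size.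
Qed.

Lemma size_adm_words_gt L S n : (0 < L)%N -> (2 <= L + S)%N ->
  (n < size (adm_words L S n))%N.
Proof.
move=> L_gt0 LS_ge2; elim: n => // n IHn; rewrite size_adm_wordsS //.
have := adm_long_words_gt0 S n L_gt0; nia.
Qed.

(** The blocks of last letters below [L] come first in the enumeration. Hence the [take] in [Lambda]
    will amount to a filter on the last letter. *)
Lemma adm_long_words_prefix L S n : (0 < L)%N ->
  prefix [seq w <- adm_words L S n | last 0%N w < L]%N (adm_words L S n).
Proof.
case: n => [|n] L_gt0; first by rewrite /adm_words /= L_gt0.
rewrite adm_long_wordsS // adm_wordsS //.
have -> : (L + S).-1 = (L.-1 + S)%N by lia.
by rewrite iotaD allpairs_cat catA prefix_prefix.
Qed.

(** * The partitions *)

Section Partitions.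
Variables (R : realFieldType) (L S : nat) (gamma : R).
Hypotheses (L_gt0 : (0 < L)%N) (LS_ge2 : (2 <= L + S)%N).
Hypothesis gamma_gt0 : 0 < gamma.
Hypothesis gammaE : L%:R * gamma + S%:R * gamma ^+ 2 = 1.

Lemma gamma_lt1 : gamma < 1.
Proof.
rewrite ltNge; apply/negP => ge1.
have LSR : 2%:R <= L%:R + S%:R :> R by rewrite -natrD ler_nat.
have := lerD (ler_wpM2l (ler0n R L) ge1) (ler_wpM2l (ler0n R S) (exprn_ege1 2 ge1)).
rewrite gammaE !mulr1 => /(le_trans LSR); lra.
Qed.

Lemma ilen_homothetic (U V : R * R) : ilen (homothetic U V) = ilen U * ilen V.
Proof. by rewrite /homothetic /ilen /=; ring. Qed.

Lemma ilen_LS_pattern :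
  [seq ilen V | V <- LS_pattern L S gamma] = nseq L gamma ++ nseq S (gamma ^+ 2).
Proof.
have map_iota_const (f : nat -> R) c k :
    (forall i, f i = c) -> [seq f i | i <- iota 0 k] = nseq k c.
  by move=> fc; rewrite (eq_map fc); elim: k 0%N => //= k IHk m; rewrite IHk.
rewrite /LS_pattern map_cat -!map_comp; congr (_ ++ _); apply: map_iota_const => i;
  rewrite /ilen /= -natr1; ring.
Qed.

(** The maximal length is [g]. A split interval yields [L] pieces of length [g * gamma] and [S]
    shorter ones, while an interval of length [g * gamma] survives and becomes long. *)
Lemma refineP (g : R) (P : seq (R * R)) : 0 < g ->
  all (fun U => (ilen U == g) || (ilen U == g * gamma)) P ->
  has (fun U => ilen U == g) P ->
  let Q := refine L S gamma P in
  let l := count (fun U => ilen U == g) P in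
  [/\ size Q = (size P + (L + S).-1 * l)%N,
      count (fun U => ilen U == g * gamma) Q = (size P + L.-1 * l)%N &
      all (fun U => (ilen U == g * gamma) || (ilen U == g * gamma * gamma)) Q].
Proof.
move=> g_gt0 twoP longP Q l.
have lt_g : g * gamma < g by rewrite gtr_pMr // gamma_lt1.
have lt_gg : g * gamma * gamma < g * gamma by rewrite gtr_pMr ?gamma_lt1 ?mulr_gt0.
(* Maximality refers to the whole of [P] and is not inherited by its tail; the equivalent test on
   [U] alone makes induction on [P] possible. *)
have -> : Q = flatten [seq if ilen U == g
    then [seq homothetic U V | V <- LS_pattern L S gamma] else [:: U] | U <- P].
  congr flatten; apply/eq_in_map => U UP; congr (if _ then _ else _).
  apply/allP/eqP => [maxU|Ug V VP].
    have /hasP[V VP /eqP Vg] := longP; have := maxU V VP; rewrite Vg.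
    by have /orP[/eqP->|/eqP->] // := allP twoP U UP; rewrite leNgt lt_g.
  by rewrite Ug; have /orP[/eqP->|/eqP->] // := allP twoP V VP; apply: ltW.
have sizeV U : size [seq homothetic U V | V <- LS_pattern L S gamma] = (L + S)%N.
  by rewrite size_map -(size_map (@ilen R)) ilen_LS_pattern size_cat !size_nseq.
have lenV U : ilen U = g ->
    [seq ilen V | V <- [seq homothetic U V | V <- LS_pattern L S gamma]]
      = nseq L (g * gamma) ++ nseq S (g * gamma * gamma).
  move=> Ug; rewrite -map_comp (eq_map (g := fun V => g * ilen V)); last first.
    by move=> V /=; rewrite ilen_homothetic Ug.
  by rewrite (map_comp ( *%R g)) ilen_LS_pattern map_cat !map_nseq expr2 mulrA.
rewrite {}/Q {}/l {longP}; elim: P twoP => [|U P IHP] /=.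
  by split=> //; rewrite muln0.
move=> /andP[Utwo /IHP[IHP1 IHP2 IHP3]].
rewrite size_cat count_cat all_cat IHP1 IHP2 IHP3 andbT.
case: eqP Utwo => [Ug _|_ /= Ugg]; last first.
  by rewrite /= Ugg; split; lia.
rewrite sizeV -(count_map (@ilen R) (pred1 (g * gamma))) lenV // count_cat !count_nseq /=.
rewrite eqxx (lt_eqF lt_gg) /= mul0n mul1n.
split; [lia | lia |].
rewrite -(all_map (@ilen R)
  (fun x => (x == g * gamma) || (x == g * gamma * gamma))) lenV //.
by rewrite all_cat !all_nseq !eqxx !orbT.
Qed.

(** With [g = gamma ^ n], [refineP] gives the same recursion as for admissible words, and the unit
    interval matches the empty word. *)
Lemma LS_partitionP n :
  [/\ all (fun U => (ilen U == gamma ^+ n) || (ilen U == gamma ^+ n.+1))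
          (LS_partition L S gamma n),
      nb_intervals L S gamma n = size (adm_words L S n) &
      nb_long L S gamma n = count (fun w => last 0 w < L)%N (adm_words L S n)].
Proof.
rewrite /nb_intervals /nb_long.
elim: n => [|n [IHall IHsize IHlong]].
  by rewrite /= /adm_words /= L_gt0 /ilen subr0 !eqxx.
rewrite exprSr in IHall.
have := refineP (exprn_gt0 n gamma_gt0) IHall.
rewrite has_count IHlong adm_long_words_gt0 // => /(_ isT)[].
rewrite IHsize -exprSr size_adm_wordsS // count_adm_long_wordsS //.
by rewrite /LS_partition iterS !exprSr.
Qed.

End Partitions.

(** * The points *)

Section Points.
Variables (R : realFieldType) (L S : nat) (gamma : R).
Hypotheses (L_gt0 : (0 < L)%N) (LS_ge2 : (2 <= L + S)%N).
Hypothesis gamma_gt0 : 0 < gamma.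
Hypothesis gammaE : L%:R * gamma + S%:R * gamma ^+ 2 = 1.

(** The constant term of the affine map [psi_i]. *)
Definition psi_shift (i : nat) : R :=
  if (i < L)%N then i%:R * gamma else L%:R * gamma + (i - L)%:R * gamma ^+ 2.

(** The value of [psi_word] at [0] with the domain tests removed, hence a total function. *)
Definition word_point (w : seq nat) : R :=
  foldr (fun i y => gamma * y + psi_shift i) 0 w.

Lemma psi_shift0 : psi_shift 0 = 0.
Proof. by rewrite /psi_shift L_gt0 mul0r. Qed.

Lemma psi_shift_le i j : (i <= j)%N -> psi_shift i <= psi_shift j.
Proof.
have gamma_ge0 := ltW gamma_gt0; have gamma2_ge0 := exprn_ge0 2 gamma_ge0.
rewrite /psi_shift => ij; case: ltnP => iL; case: ltnP => jL; last 2 first.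
- lia.
- by rewrite lerD2l ler_wpM2r // ler_nat leq_sub2r.
- by rewrite ler_wpM2r // ler_nat.
rewrite (@le_trans _ _ (L%:R * gamma)) //; first by rewrite ler_wpM2r // ler_nat ltnW.
by rewrite lerDl mulr_ge0.
Qed.

Lemma word_point_rcons w i :
  word_point (rcons w i) = word_point w + gamma ^+ size w * psi_shift i.
Proof.
elim: w => [|j w IHw] /=; first by rewrite mulr0 expr0 mul1r.
by rewrite IHw exprS; ring.
Qed.

(* The third conjunct makes the value lie in the domain of psi_i for i >= L,
   which an admissible word only applies after psi_0 or at the point 0. *)
Lemma psi_word_adm (w : seq nat) :
  all (fun i => i < L + S)%N w -> sorted (fun i j => ~~ E_LS L S i j) w ->
  [/\ psi_word L S gamma w 0 = Some (word_point w),
      0 <= word_point w < 1 & head 0%N w = 0%N -> word_point w < gamma].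
Proof.
have lt1 := gamma_lt1 LS_ge2 gammaE.
elim: w => [|i w IHw] /=; first by rewrite lexx ltr01.
move=> /andP[ib wb] adm_iw.
have [-> /andP[p_ge0 p_lt1] p_lt] := IHw wb (path_sorted adm_iw).
set p := word_point w in p_ge0 p_lt1 p_lt *.
have shift_ge0 : 0 <= psi_shift i by rewrite -psi_shift0 psi_shift_le.
have gp_ge0 : 0 <= gamma * p by rewrite mulr_ge0 // ltW.
rewrite /= addr_ge0 //; case: (ltnP i L) => iL.
  have gp_lt : gamma * p < gamma by rewrite gtr_pMr.
  have shiftE : psi_shift i = i%:R * gamma by rewrite /psi_shift iL.
  rewrite /psi iL p_ge0 p_lt1 -shiftE; split=> // [|i0]; last first.
    by rewrite i0 psi_shift0 addr0.
  (* The image lies below [(i + 1) * gamma], which is at most [L * gamma], hence at most 1. *)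
  rewrite -[ltRHS]gammaE shiftE (@lt_le_trans _ _ (i.+1%:R * gamma)) //.
    by rewrite -natr1 mulrDl mul1r addrC ltrD2l.
  apply: ler_wpDr; first by rewrite mulr_ge0 // exprn_ge0 // ltW.
  by rewrite ler_pM2r // ler_nat.
(* As [i] is at least [L], admissibility forces [w] to be empty or to start with [0]. *)
have {}p_lt : p < gamma.
  apply: p_lt; case: w wb adm_iw {IHw p p_ge0 p_lt1 gp_ge0} => //= j w /andP[jb _].
  by rewrite /E_LS => /andP[Eij _]; lia.
have shiftE : psi_shift i = L%:R * gamma + (i - L)%:R * gamma ^+ 2.
  by rewrite /psi_shift ltnNge iL.
rewrite /psi ltnNge iL ib p_ge0 p_lt /= -addrA -shiftE; split=> // [|i0]; last by lia.
have gp_lt : gamma * p < gamma ^+ 2 by rewrite expr2 ltr_pM2l.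
(* The image lies in the short interval of index [i - L], and [i - L + 1] is at most [S]. *)
rewrite -[ltRHS]gammaE shiftE addrCA ltrD2l.
rewrite (@lt_le_trans _ _ ((i - L).+1%:R * gamma ^+ 2)) //.
  by rewrite -natr1 mulrDl mul1r addrC ltrD2l.
by rewrite ler_pM2r ?exprn_gt0 // ler_nat; lia.
Qed.

Lemma LambdaE n : (0 < n)%N ->
  Lambda L S gamma n = [seq word_point w | w <- adm_words L S n].
Proof.
case: n => // n _; elim: n => [|n IHn].
  transitivity (sort <=%R [seq U.1 | U <- LS_partition L S gamma 1]) => //.
  have -> : LS_partition L S gamma 1 = LS_pattern L S gamma.
    rewrite /LS_partition /= /refine /= /ilen lexx /= cats0 -[RHS]map_id.
    by apply/eq_in_map => -[a b] _; rewrite /homothetic /ilen /= subr0 !mul1r !add0r.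
  have -> : [seq U.1 | U <- LS_pattern L S gamma] =
      [seq psi_shift i | i <- iota 0 (L + S)].
    rewrite iotaD /LS_pattern !map_cat -!map_comp; congr (_ ++ _).
      by apply/eq_in_map => i; rewrite mem_iota /psi_shift /= add0n => ->.
    rewrite add0n -[X in _ = map _ (iota X _)]addn0 iotaDl -map_comp.
    apply: eq_map => j /=.
    by rewrite /psi_shift ltnNge leq_addr addKn.
  rewrite sorted_sort; last 2 first.
  - exact: le_trans.
  - by apply: (homo_sorted psi_shift_le); apply: iota_sorted.
  rewrite adm_wordsS // /adm_words /= L_gt0 /=.
  case: (L + S)%N LS_ge2 => // b _ /=.
  rewrite mulr0 add0r allpairs1r -map_comp; congr (_ :: _).
  by apply: eq_map => i /=; rewrite mulr0 add0r.
have -> : Lambda L S gamma n.+2 =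
  [seq word_point w | w <- adm_words L S n.+1] ++
  [seq x + gamma ^+ n.+1 * psi_shift i | i <- iota 1 (L + S).-1,
     x <- take (nb_long L S gamma n.+1) (Lambda L S gamma n.+1)].
  (* The letter [L] belongs to [phi]: its two possible formulas agree since [i - L] vanishes. So [L]
     blocks [phi] and [S - 1] blocks [phiL] exhaust the nonzero letters when [S] is positive. *)
  have phiE i x : (i <= L)%N -> phi gamma n.+2 i x = x + gamma ^+ n.+1 * psi_shift i.
    rewrite /phi /psi_shift => iL; case: ltnP => Li; first by rewrite exprS; ring.
    by have -> : i = L by [lia]; rewrite subnn exprS; ring.
  have phiLE j x : phiL L gamma n.+2 j x = x + gamma ^+ n.+1 * psi_shift (L + j).
    by rewrite /phiL /psi_shift ltnNge leq_addr /= addKn !exprS; ring.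
  rewrite -IHn [LHS]/Lambda -/(Lambda L S gamma n.+1); congr (_ ++ _).
  set X := take _ _; case: S LS_ge2 phiLE => [|s] _ phiLE.
    rewrite cats0 addn0; apply/eq_in_allpairs => i x; rewrite mem_iota => iL _.
    by rewrite phiE //; lia.
  rewrite addnS /= iotaD allpairs_cat; congr (_ ++ _).
    apply/eq_in_allpairs => i x; rewrite mem_iota => iL _.
    by rewrite phiE //; lia.
  rewrite addnC iotaDl allpairs_mapl; apply/eq_in_allpairs => j x _ _.
  exact: phiLE.
rewrite [in RHS]adm_wordsS // map_cat -map_comp; congr (_ ++ _).
  by apply: eq_map => w /=; rewrite word_point_rcons psi_shift0 mulr0 addr0.
have [_ _ ->] := LS_partitionP L_gt0 LS_ge2 gamma_gt0 gammaE n.+1.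
rewrite IHn -map_take -size_filter.
(* The first [nb_long] words are exactly those with last letter below [L]. *)
have := adm_long_words_prefix S n.+1 L_gt0; rewrite prefixE => /eqP ->.
rewrite map_allpairs allpairs_mapr; apply/eq_in_allpairs => i w _.
rewrite mem_filter => /andP[_]; rewrite mem_filter mem_digit_words.
by move=> /andP[_ /andP[/eqP sw _]]; rewrite word_point_rcons sw.
Qed.

Lemma size_Lambda n : (n <= size (Lambda L S gamma n))%N.
Proof.
by case: n => // n; rewrite LambdaE // size_map ltnW // size_adm_words_gt.
Qed.

Lemma LambdaD n k : prefix (Lambda L S gamma n) (Lambda L S gamma (n + k)).
Proof.
elim: k => [|k IHk]; first by rewrite addn0 prefix_refl.
rewrite addnS; apply: prefix_trans IHk _.
by case: (n + k)%N => [|m]; rewrite ?prefix0s //= prefix_prefix.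
Qed.

(** Of [Lambda n] and [Lambda m.+1] one is a prefix of the other, and the index [m] is valid in
    both, so the default of [nth] is never reached. *)
Lemma LS_point_Lambda n m : (m < size (Lambda L S gamma n))%N ->
  LS_point L S gamma m.+1 = nth 0 (Lambda L S gamma n) m.
Proof.
rewrite /LS_point -pred_Sn => mn.
have mm := size_Lambda m.+1.
case/orP: (leq_total n m.+1) => /subnKC le_nm.
  have /prefixP[s E] := LambdaD n (m.+1 - n).
  by move: E; rewrite le_nm => ->; rewrite nth_cat mn.
have /prefixP[s E] := LambdaD m.+1 (n - m.+1).
by move: E; rewrite le_nm => ->; rewrite nth_cat mm.
Qed.

End Points.

Theorem proposition4p3 (R : realType) (L S : nat) (gamma : R)
  (hL : (1 <= L)%N) (hLS : (2 <= L + S)%N)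
  (gamma_gt0 : 0 < gamma)
  (gammaE : L%:R * gamma + S%:R * gamma ^+ 2 = 1)
  (n : nat) (hn : (1 <= n)%N) :
  [seq LS_point L S gamma m | m <- iota 1 (nb_intervals L S gamma n)]
    = Lambda L S gamma n
  /\ [seq Some x | x <- Lambda L S gamma n]
     = [seq psi_word L S gamma [seq val i | i <- w] 0
          | w : n.-tuple 'I_(L + S) <- admissible_tuples L S n].
Proof.
have [_ sizeI _] := LS_partitionP hL hLS gamma_gt0 gammaE n.
have LambdaE := LambdaE hL hLS gamma_gt0 gammaE hn.
have sizeL : nb_intervals L S gamma n = size (Lambda L S gamma n).
  by rewrite LambdaE size_map.
split.
  rewrite sizeL -[RHS](mkseq_nth 0) /mkseq -[1%N]addn0 iotaDl -map_comp.
  apply/eq_in_map => m; rewrite mem_iota => /= m_lt.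
  exact: LS_point_Lambda.
rewrite LambdaE -map_comp.
(* Passing from tuples of ordinals to words of naturals turns both sides into maps over
   [adm_words]. *)
rewrite (map_comp (fun w => psi_word L S gamma w 0)) map_admissible_tuples.
apply/eq_in_map => w; rewrite mem_filter mem_digit_words => /and3P[adm_w _ w_lt].
by have [] := psi_word_adm hL hLS gamma_gt0 gammaE w_lt adm_w.
Qed.
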